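(* Let $\mathfrak g$ be a nonsemisimple complex Lie algebra, $\mathfrak p$ a nonperfect ideal of $\mathfrak g$, and $\phi:\mathfrak p\to\mathbb C$ a Lie algebra homomorphism. Choose a totally ordered basis $\{y_j\}_{j\in J}$ of a complement of $\mathfrak p$ in $\mathfrak g^{\phi}$ and let $\mathbb C[y]\subseteq\mathcal U(\mathfrak g)$ be the span of the ordered monomials $y^\beta=y_{j_1}^{\beta_{j_1}}\cdots y_{j_n}^{\beta_{j_n}}$ ($j_1<\dots<j_n$, $\beta\in\mathbb Z_+^J$ finitely supported), with $\mathbb C[y]=\mathbb C$ if $J=\emptyset$. Then the space of quasi-Whittaker vectors of type $\phi$ in the universal quasi-Whittaker module satisfies $$W(\phi)_{\phi}=\mathbb C[y]\,w_{\phi}.$$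
   Context: All vector spaces and Lie algebras are over $\mathbb C$. A Lie algebra homomorphism $\phi:\mathfrak p\to\mathbb C$ is a linear map vanishing on $[\mathfrak p,\mathfrak p]$. For a $\mathfrak g$-module $V$, a vector $v\in V$ is a quasi-Whittaker vector of type $\phi$ if $pv=\phi(p)v$ for all $p\in\mathfrak p$; $V_\phi=\{v\in V: pv=\phi(p)v\ \forall p\in\mathfrak p\}$. Let $\mathbb C w_\phi$ be the one-dimensional $\mathfrak p$-module with $pw_\phi=\phi(p)w_\phi$, and $W(\phi)=\mathcal U(\mathfrak g)\otimes_{\mathcal U(\mathfrak p)}\mathbb C w_\phi$ (the universal quasi-Whittaker module of type $\phi$); $w_\phi$ denotes $1\otimes w_\phi$. The Whittaker annihilator of $\phi$ is $\mathfrak g^{\phi}=\{g\in\mathfrak g:\phi([g,p])=0\ \forall p\in\mathfrak p\}$; it is a subalgebra of $\mathfrak g$ containing $\mathfrak p$. *)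

(* Defs.v *)
From mathcomp Require Import all_boot all_order all_algebra complex.
From mathcomp Require Export reals.
Set Implicit Arguments. Unset Strict Implicit. Unset Printing Implicit Defensive.
Import Order.TTheory GRing.Theory Num.Theory.
Local Open Scope ring_scope.

Section LieDefs.
Variable K : fieldType.

Definition lin_span (V : lmodType K) (S : V -> Prop) (v : V) : Prop :=
  exists (n : nat) (c : 'I_n -> K) (x : 'I_n -> V),
    (forall i, S (x i)) /\ v = \sum_(i < n) c i *: x i.

Definition subspace (V : lmodType K) (S : V -> Prop) : Prop :=
  S 0 /\ forall a x y, S x -> S y -> S (a *: x + y).

Definition finite_dim (V : lmodType K) : Prop :=
  exists (n : nat) (e : 'I_n -> V), forall v, lin_span (fun x => exists i, x = e i) v.

Variable g : lmodType K.

Definition is_lie_bracket (br : g -> g -> g) : Prop :=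
  [/\ (forall a x y z, br (a *: x + y) z = a *: br x z + br y z),
      (forall a x y z, br z (a *: x + y) = a *: br z x + br z y),
      (forall x, br x x = 0) &
      (forall x y z, br x (br y z) + br y (br z x) + br z (br x y) = 0)].

Variable br : g -> g -> g.

Definition lie_ideal (I : g -> Prop) : Prop :=
  subspace I /\ forall x y, I y -> I (br x y).

Definition derived (I : g -> Prop) : g -> Prop :=
  lin_span (fun z => exists x y, [/\ I x, I y & z = br x y]).

Definition perfect (I : g -> Prop) : Prop := forall z, I z <-> derived I z.

Fixpoint derived_series (I : g -> Prop) (n : nat) : g -> Prop :=
  match n with 0 => I | n'.+1 => derived (derived_series I n') end.

Definition solvable_ideal (I : g -> Prop) : Prop :=
  lie_ideal I /\ exists n, forall z, derived_series I n z -> z = 0.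

Definition semisimple : Prop :=
  finite_dim g /\ forall I, solvable_ideal I -> forall z, I z -> z = 0.

(* phi : p -> K is a Lie algebra homomorphism (only its values on p matter) *)
Definition lie_hom_on (P : g -> Prop) (phi : g -> K) : Prop :=
  (forall a x y, P x -> P y -> phi (a *: x + y) = a * phi x + phi y) /\
  (forall x y, P x -> P y -> phi (br x y) = 0).

Definition whittaker_annihilator (P : g -> Prop) (phi : g -> K) (z : g) : Prop :=
  forall x, P x -> phi (br z x) = 0.

Definition is_lie_module (V : lmodType K) (act : g -> V -> V) : Prop :=
  [/\ (forall a x y v, act (a *: x + y) v = a *: act x v + act y v),
      (forall a x v u, act x (a *: v + u) = a *: act x v + act x u) &
      (forall x y v, act (br x y) v = act x (act y v) - act y (act x v))].

Definition module_hom (V : lmodType K) (actV : g -> V -> V)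
  (U : lmodType K) (actU : g -> U -> U) (f : V -> U) : Prop :=
  (forall a v u, f (a *: v + u) = a *: f v + f u) /\
  (forall x v, f (actV x v) = actU x (f v)).

Definition quasi_whittaker (P : g -> Prop) (phi : g -> K)
  (V : lmodType K) (act : g -> V -> V) (v : V) : Prop :=
  forall x, P x -> act x v = phi x *: v.

(* (W, w) is the universal quasi-Whittaker module of type phi, characterized
   by its universal property (Frobenius reciprocity for
   U(g) (x)_{U(p)} C w_phi). *)
Definition universal_qwhittaker (P : g -> Prop) (phi : g -> K)
  (W : lmodType K) (actW : g -> W -> W) (w : W) : Prop :=
  [/\ is_lie_module actW, quasi_whittaker P phi actW w &
   forall (V : lmodType K) (actV : g -> V -> V) (v : V),
     is_lie_module actV -> quasi_whittaker P phi actV v ->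
     exists f : W -> V,
       [/\ module_hom actW actV f, f w = v &
        forall f' : W -> V, module_hom actW actV f' -> f' w = v ->
          forall u, f' u = f u]].

(* Ordered monomial y_{j1}^{b1} ... y_{jn}^{bn} (j1 < ... < jn) applied to w,
   encoded by the list [:: (j1,b1); ...; (jn,bn)]. *)
Definition ordered_monomial_act (d : Order.disp_t) (J : orderType d)
  (V : lmodType K) (act : g -> V -> V) (y : J -> g)
  (s : seq (J * nat)) (w : V) : V :=
  foldr (fun jb v => iter jb.2 (act (y jb.1)) v) w s.

Definition ordered_monomial_vec (d : Order.disp_t) (J : orderType d)
  (V : lmodType K) (act : g -> V -> V) (y : J -> g) (w : V) (u : V) : Prop :=
  exists s : seq (J * nat),
    sorted (fun a b : J => (a < b)%O) (map fst s) /\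
    u = ordered_monomial_act act y s w.

End LieDefs.

(* Main.v *)
(* Let M be the span of the ordered monomials applied to w. It consists of
   quasi-Whittaker vectors and is stable under the Whittaker annihilator A, and
   M generates W. Filter W by the products of at most n elements of g applied
   to M. For x in P, the operator D_x := x - phi(x) kills M and lowers the
   filtration. Given finitely many elements of g, choose pairs (z_i, x_i) with
   x_i in P that are dual under (z, x) |-> phi [x, z] modulo A; the Euler
   operator sum_i z_i D_{x_i} then acts on the n-th graded piece as
   multiplication by n. It kills quasi-Whittaker vectors, so in characteristic 0
   such a vector descends through the filtration down to M. Only spanning by
   monomials is used, not the linear independence given by the PBW theorem. *)
Require Import Defs.
From mathcomp Require Import all_boot all_order all_algebra complex.
From mathcomp Require Import reals boolp.
From HB Require Import structures.
Import Order.TTheory GRing.Theory Num.Theory.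
Local Open Scope ring_scope.
Set Implicit Arguments. Unset Strict Implicit. Unset Printing Implicit Defensive.

(** * Subspaces, linear spans, and subspaces as modules in their own right *)

Section Subspaces.
Variables (K : fieldType) (V : lmodType K).
Implicit Types S T : V -> Prop.

Lemma subspaceD S x y : subspace S -> S x -> S y -> S (x + y).
Proof. by move=> [_ Sl] Sx Sy; rewrite -[x]scale1r; apply: Sl. Qed.

Lemma subspaceZ S a x : subspace S -> S x -> S (a *: x).
Proof. by move=> [S0 Sl] Sx; rewrite -[_ *: _]addr0; apply: Sl. Qed.

Lemma subspaceB S x y : subspace S -> S x -> S y -> S (x - y).
Proof. by move=> [_ Sl] Sx Sy; rewrite addrC -scaleN1r; apply: Sl. Qed.

Lemma subspace_sum S (I : eqType) (r : seq I) (F : I -> V) :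
  subspace S -> (forall i, i \in r -> S (F i)) -> S (\sum_(i <- r) F i).
Proof.
move=> HS HF; rewrite big_seq; elim/big_ind: _ => //; first by case: HS.
by move=> x y Sx Sy; apply: subspaceD.
Qed.

(** Linearity of [f] is asked on [S] alone because [phi] is linear only on [P]. *)
Lemma subspace_linear_sum S (I : eqType) (r : seq I) (c : I -> K) (F : I -> V)
    (f : V -> K) : subspace S ->
  (forall a x y, S x -> S y -> f (a *: x + y) = a * f x + f y) ->
  (forall i, i \in r -> S (F i)) ->
  f (\sum_(i <- r) c i *: F i) = \sum_(i <- r) c i * f (F i).
Proof.
move=> HS flin; have S0 : S 0 by case: HS.
elim: r => [_|i r IH SF].
  by have := flin (-1) 0 0 S0 S0; rewrite !big_nil scaler0 addr0 mulN1r addNr.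
have SFr j : j \in r -> S (F j) by move=> jr; apply: SF; rewrite inE jr orbT.
rewrite !big_cons flin ?IH //; first by apply: SF; rewrite mem_head.
by apply: subspace_sum => // j jr; apply: subspaceZ => //; apply: SFr.
Qed.

Lemma lin_span_gen S x : S x -> lin_span S x.
Proof.
move=> Sx; exists 1%N, (fun=> 1), (fun=> x); split=> //.
by rewrite big_ord1 scale1r.
Qed.

Lemma lin_span_subspace S : subspace (lin_span S).
Proof.
split; first by exists 0%N, (fun=> 0), (fun=> 0); split=> [[]//|]; rewrite big_ord0.
move=> a _ _ [n [c [x [Sx ->]]]] [m [e [z [Sz ->]]]].
exists (n + m)%N,
  (fun i => match split i with inl j => a * c j | inr j => e j end),
  (fun i => match split i with inl j => x j | inr j => z j end).
split=> [i|]; first by case: (split i).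
rewrite big_split_ord scaler_sumr; congr (_ + _); apply: eq_bigr => i _.
  by rewrite -/(unsplit (inl i)) unsplitK scalerA.
by rewrite -/(unsplit (inr i)) unsplitK.
Qed.

Lemma lin_span_min S T :
  subspace T -> (forall x, S x -> T x) -> forall x, lin_span S x -> T x.
Proof.
move=> HT ST _ [n [c [x [Sx ->]]]]; apply: subspace_sum => // i _.
by apply: subspaceZ => //; apply: ST.
Qed.

(** The universal property quantifies over carrier types, so a subspace must become an [lmodType].
    Membership is made boolean classically, and the proof [HS] is an argument so that the closure
    instance can be inferred from the predicate. *)
Definition subspace_pred S of subspace S : {pred V} := fun v => `[< S v >].

Fact subspace_pred_closed S (HS : subspace S) : submod_closed (subspace_pred HS).
Proof.
case: (HS) => S0 Sl; split=> [|a x z /asboolP Sx /asboolP Sz]; apply/asboolP => //.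
exact: Sl.
Qed.

HB.instance Definition _ S (HS : subspace S) :=
  GRing.isSubmodClosed.Build K V (subspace_pred HS) (subspace_pred_closed HS).

Record subspace_type S (HS : subspace S) :=
  SubspaceType { subspace_val :> V; _ : subspace_val \in subspace_pred HS }.

HB.instance Definition _ S (HS : subspace S) :=
  [isSub for @subspace_val S HS].
HB.instance Definition _ S (HS : subspace S) :=
  [Choice of subspace_type HS by <:].
HB.instance Definition _ S (HS : subspace S) :=
  [SubChoice_isSubLmodule of subspace_type HS by <:].

Lemma subspace_typeP S (HS : subspace S) (v : subspace_type HS) : S (val v).
Proof. by case: v => v /= /asboolP. Qed.

Lemma subspace_val_linear S (HS : subspace S) a (u v : subspace_type HS) :
  val (a *: u + v) = a *: val u + val v.
Proof. exact: linearP. Qed.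

Lemma subspace_valZ S (HS : subspace S) a (u : subspace_type HS) :
  val (a *: u) = a *: val u.
Proof. exact: linearZ. Qed.

End Subspaces.

(** * Generation of the universal module by its cyclic vector *)

Section Generation.
Variables (K : fieldType) (g : lmodType K) (br : g -> g -> g).
Variables (P : g -> Prop) (phi : g -> K).
Variables (W : lmodType K) (actW : g -> W -> W) (w : W).

(** The universal map from [W] to the submodule [S], followed by the inclusion into [W], is an
    endomorphism fixing [w]. By uniqueness it is the identity, so its image [S] is everything. *)
Lemma universal_qwhittaker_generated (S : W -> Prop) :
  universal_qwhittaker br P phi actW w -> subspace S -> S w ->
  (forall x u, S u -> S (actW x u)) -> forall u, S u.
Proof.
move=> [[aDl aDr aB] qw univ] HS Sw Sact u.
pose N : lmodType K := subspace_type HS.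
have inN v : S v -> v \in subspace_pred HS by move=> /asboolP.
pose mk v (Sv : S v) : N := SubspaceType (inN v Sv).
pose actN x (v : N) : N := mk _ (Sact x _ (subspace_typeP v)).
have modN : is_lie_module br actN.
  split=> [a x z v|a x v v'|x z v]; apply: val_inj.
  - by rewrite subspace_val_linear -aDl.
  - by rewrite subspace_val_linear -aDr -subspace_val_linear.
  - rewrite -[actN x _ - _]addrC -scaleN1r subspace_val_linear scaleN1r addrC.
    exact: aB.
have qN : quasi_whittaker P phi actN (mk w Sw).
  move=> x Px; apply: val_inj.
  by rewrite subspace_valZ -qw.
have [f [[flin fact] fw _]] := univ N actN (mk w Sw) modN qN.
(* [h] is the unique endomorphism fixing [w]; the identity and the composite through [N] are both
   compared with it. *)
have [h [_ _ huniq]] := univ W actW w (And3 aDl aDr aB) qw.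
have -> : u = h u by apply: (huniq id).
have <- := huniq (fun v => val (f v)); first exact: subspace_typeP.
  split=> [a v v'|x v]; first by rewrite flin subspace_val_linear.
  by rewrite fact.
by rewrite fw.
Qed.
End Generation.

(** * The pairing [phi (br x z)] of [P] with the Lie algebra, and dual families modulo its
    annihilator *)

Section LieAlgebra.
Variables (K : fieldType) (g : lmodType K) (br : g -> g -> g).
Hypothesis Hlie : is_lie_bracket br.

Lemma lie_bracketC x z : br x z = - br z x.
Proof.
case: Hlie => brl brr br0 _; have := br0 (x + z).
have brD u v t : br (u + v) t = br u t + br v t.
  by have := brl 1 u v t; rewrite !scale1r.
have brDr u v t : br t (u + v) = br t u + br t v.
  by have := brr 1 u v t; rewrite !scale1r.
rewrite brD !brDr !br0 add0r addr0 => /eqP.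
by rewrite addr_eq0 => /eqP.
Qed.

Variables (P : g -> Prop) (phi : g -> K).
Hypotheses (HP : lie_ideal br P) (Hphi : lie_hom_on br P phi).
Local Notation A := (whittaker_annihilator br P phi).

Let PB x b : P x -> P (br x b).
Proof.
move=> Px; rewrite lie_bracketC -scaleN1r; case: HP => Psub Pbr.
by apply: subspaceZ => //; apply: Pbr.
Qed.

Lemma lie_hom_onB x z : P x -> P z -> phi (x - z) = phi x - phi z.
Proof.
move=> Px Pz; case: Hphi => phil _.
by rewrite addrC -scaleN1r phil // mulN1r addrC.
Qed.

Lemma lie_hom_on_bracketr x a b c : P x ->
  phi (br x (a *: b + c)) = a * phi (br x b) + phi (br x c).
Proof.
case: Hlie => _ brr _ _ Px; rewrite brr.
by case: Hphi => -> //; apply: PB.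
Qed.

Lemma lie_hom_on_bracketl x z a b : P x -> P z ->
  phi (br (a *: x + z) b) = a * phi (br x b) + phi (br z b).
Proof.
case: Hlie => brl _ _ _ Px Pz; rewrite brl.
by case: Hphi => -> //; apply: PB.
Qed.

Let phi0 : phi 0 = 0.
Proof.
by case: HP => [[P0 _] _]; rewrite -[X in phi X](subrr (0 : g)) lie_hom_onB // subrr.
Qed.

Let phiN x : P x -> phi (- x) = - phi x.
Proof.
by move=> Px; case: HP => [[P0 _] _]; rewrite -sub0r lie_hom_onB // phi0 sub0r.
Qed.

Lemma whittaker_annihilatorP z :
  A z <-> forall x, P x -> phi (br x z) = 0.
Proof.
split=> H x Px; rewrite lie_bracketC phiN ?H ?oppr0 //; last exact: PB.
by case: HP => _; apply.
Qed.

Lemma whittaker_annihilator_subspace : subspace A.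
Proof.
have PP z x : P x -> P (br z x) by case: HP => _; apply.
have [brl _ _ _] := Hlie.
split=> [x Px|a b c Ab Ac x Px]; last first.
  case: Hphi => phil _.
  by rewrite brl phil ?Ab ?Ac ?mulr0 ?addr0 //; apply: PP.
have := brl (-1) x x x; rewrite !scaleN1r !addNr => ->; exact: phi0.
Qed.

(** By Jacobi, [br p (br x z)] is minus the sum of [br x (br z p)] and [br z (br p x)]. The inner
    brackets lie in the ideal [P], so [phi] kills both terms. *)
Lemma whittaker_annihilator_bracket x z : A x -> A z -> A (br x z).
Proof.
move=> Ax Az; apply/whittaker_annihilatorP => p Pp.
have [_ _ _ jac] := Hlie; have := jac p x z.
have [Psub Pbr] := HP.
have Pzp : P (br z p) by apply: Pbr.
rewrite -addrA => /eqP; rewrite addr_eq0 => /eqP ->.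
rewrite phiN; last first.
  apply: subspaceD => //; first by apply/Pbr/Pbr.
  by apply/Pbr/PB.
rewrite -[X in X + _]scale1r; case: Hphi => -> //; last 2 first.
- by apply/Pbr/Pbr.
- by apply/Pbr/PB.
by rewrite Ax // Az ?mulr0 ?addr0 ?oppr0 //; apply: PB.
Qed.

(* A new [b] is adjoined through its defect [b - T b], paired with an [x] that is
   first corrected so as to pair to zero with the earlier elements. *)
Lemma dual_family (L : seq g) :
  exists2 zs : seq (g * g), (forall p, p \in zs -> P p.2) &
    forall b, b \in L -> A (b - \sum_(p <- zs) phi (br p.2 b) *: p.1).
Proof.
elim: L => [|b L [zs Pzs IH]]; first by exists [::].
pose T c := \sum_(p <- zs) phi (br p.2 c) *: p.1.
have [Ab|nAb] := pselect (A (b - T b)).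
  by exists zs => // c /[1!inE] /orP[/eqP->//|]; apply: IH.
have [x Px xb0] : exists2 x, P x & phi (br x (b - T b)) != 0.
  apply: contrapT => H; apply: nAb; apply/whittaker_annihilatorP => x Px.
  by apply: contrapT => /eqP H'; apply: H; exists x.
pose x' := x - \sum_(p <- zs) phi (br x p.1) *: p.2.
have Psub : subspace P by case: HP.
have Psum (F : g * g -> K) : P (\sum_(p <- zs) F p *: p.2).
  by apply: subspace_sum => // p /Pzs Pp; apply: subspaceZ.
have Px' : P x' by apply: subspaceB.
have phisuml (F : g * g -> K) c :
    phi (br (\sum_(p <- zs) F p *: p.2) c) = \sum_(p <- zs) F p * phi (br p.2 c).
  apply: (@subspace_linear_sum _ _ P _ zs F snd (fun z => phi (br z c)) Psub) => //.
  by move=> *; apply: lie_hom_on_bracketl.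
have phisumr (F : g * g -> K) z : P z ->
    phi (br z (\sum_(p <- zs) F p *: p.1)) = \sum_(p <- zs) F p * phi (br z p.1).
  move=> Pz.
  apply: (@subspace_linear_sum _ _ (fun=> True) _ zs F fst (fun c => phi (br z c))) => //.
  by move=> *; apply: lie_hom_on_bracketr.
(* The correction of [x] is the transpose of the defect map. Hence [x'] pairs to zero with every [c]
   whose defect is in [A], while its pairing with [b] stays nonzero. *)
have x'E c : phi (br x' c) = phi (br x (c - T c)).
  rewrite /x' [x - _]addrC [c - _]addrC -![- (\sum_(_ <- _) _)]scaleN1r.
  rewrite lie_hom_on_bracketl // lie_hom_on_bracketr //.
  rewrite phisuml phisumr // !mulN1r; congr (- _ + _).
  by apply: eq_bigr => p _; exact: mulrC.
(* The scaling makes the new summand at [b] equal to [b - T b], so the new defect of [b] is zero;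
   the sums for the elements of [L] are unchanged. *)
exists (((phi (br x (b - T b)))^-1 *: (b - T b), x') :: zs).
  by move=> p /[1!inE] /orP[/eqP->|/Pzs].
move=> c; rewrite inE big_cons /= -/(T c) x'E scalerA => /orP[/eqP->|cL].
  by rewrite mulfV // scale1r subrK subrr; case: whittaker_annihilator_subspace.
have /whittaker_annihilatorP -> // := IH _ cL.
by rewrite mul0r scale0r add0r; apply: IH.
Qed.

End LieAlgebra.

(** * Calculus of Lie module actions and the filtration by products *)

Section LieModule.
Variables (K : fieldType) (g : lmodType K) (br : g -> g -> g).
Variables (V : lmodType K) (act : g -> V -> V).
Hypothesis Hact : is_lie_module br act.

Lemma lie_actD x u v : act x (u + v) = act x u + act x v.
Proof. by case: Hact => _ ar _; rewrite -[u]scale1r ar !scale1r. Qed.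

Lemma lie_act0 x : act x 0 = 0.
Proof. by apply: (addrI (act x 0)); rewrite -lie_actD !addr0. Qed.

Lemma lie_actZ x a u : act x (a *: u) = a *: act x u.
Proof. by case: Hact => _ ar _; rewrite -[_ *: u]addr0 ar lie_act0 addr0. Qed.

Lemma lie_actB x u v : act x (u - v) = act x u - act x v.
Proof. by rewrite lie_actD -scaleN1r lie_actZ scaleN1r. Qed.

Lemma lie_act_sum x (I : Type) (r : seq I) (F : I -> V) :
  act x (\sum_(i <- r) F i) = \sum_(i <- r) act x (F i).
Proof. exact: (big_morph _ (lie_actD x) (lie_act0 x)). Qed.

Lemma lie_actDl x z u : act (x + z) u = act x u + act z u.
Proof. by case: Hact => al _ _; rewrite -[x]scale1r al !scale1r. Qed.

Lemma lie_act0l u : act 0 u = 0.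
Proof. by apply: (addrI (act 0 u)); rewrite -lie_actDl !addr0. Qed.

Lemma lie_actZl a x u : act (a *: x) u = a *: act x u.
Proof. by case: Hact => al _ _; rewrite -[_ *: x]addr0 al lie_act0l addr0. Qed.

Lemma lie_actBl x z u : act (x - z) u = act x u - act z u.
Proof. by rewrite lie_actDl -scaleN1r lie_actZl scaleN1r. Qed.

Lemma lie_act_suml (I : Type) (r : seq I) (F : I -> g) u :
  act (\sum_(i <- r) F i) u = \sum_(i <- r) act (F i) u.
Proof.
by apply: (big_morph (act^~ u)) => [x z|]; rewrite ?lie_actDl ?lie_act0l.
Qed.

Lemma lie_actC x z u : act x (act z u) = act z (act x u) + act (br x z) u.
Proof. by case: Hact => _ _ ->; rewrite addrC subrK. Qed.

(* Indexed so that stage [n.+1] holds the products of at most [n] elements of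
   [B] applied to [M]; stage 0 is the zero space. *)
Inductive pbw_filtration (B : g -> Prop) (M : V -> Prop) : nat -> V -> Prop :=
| Filtration0 n : pbw_filtration B M n 0
| FiltrationBase n u : M u -> pbw_filtration B M n.+1 u
| FiltrationLin n a u v : pbw_filtration B M n u -> pbw_filtration B M n v ->
    pbw_filtration B M n (a *: u + v)
| FiltrationAct n b u : B b -> pbw_filtration B M n.+1 u ->
    pbw_filtration B M n.+2 (act b u).
Local Notation fil := pbw_filtration.

Lemma filtration_subspace B M n : subspace (fil B M n).
Proof. by split=> [|a u v]; [exact: Filtration0|exact: FiltrationLin]. Qed.

Lemma filtration_bottom B M u : fil B M 0 u -> u = 0.
Proof.
move En : 0%N => n Fu; elim: Fu En => {n u} // n a u v _ IHu _ IHv n0.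
by rewrite IHu // IHv // scaler0 addr0.
Qed.

Lemma filtration_base B M u : subspace M -> fil B M 1 u -> M u.
Proof.
move=> [M0 Ml]; move En : 1%N => n Fu; elim: Fu En => {n u} // n a u v _ IHu _ IHv n1.
by apply: Ml; [exact: IHu|exact: IHv].
Qed.

(** The constructor [FiltrationAct] starts at stage 1, which lets inversion identify stages 0 and 1;
    at stage 0 the vector is zero and so is its image. *)
Lemma filtration_act (B : g -> Prop) M n b u :
  B b -> fil B M n u -> fil B M n.+1 (act b u).
Proof.
case: n => [|n] Bb Fu; last exact: FiltrationAct.
by rewrite (filtration_bottom Fu) lie_act0; apply: Filtration0.
Qed.

Lemma filtrationS B M n u : fil B M n u -> fil B M n.+1 u.
Proof.
elim=> {n u} [n|n u Mu|n a u v _ Fu _ Fv|n b u Bb _ Fu].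
- exact: Filtration0.
- exact: FiltrationBase.
- exact: FiltrationLin.
- exact: FiltrationAct.
Qed.

Lemma filtration_mono (B C : g -> Prop) M n u :
  (forall b, B b -> C b) -> fil B M n u -> fil C M n u.
Proof.
move=> BC; elim=> {n u} [n|n u Mu|n a u v _ Fu _ Fv|n b u Bb _ Fu].
- exact: Filtration0.
- exact: FiltrationBase.
- exact: FiltrationLin.
- by apply: FiltrationAct => //; apply: BC.
Qed.

(** A derivation of membership uses finitely many elements of [B]. This keeps the Euler operator a
    finite sum even when the Lie algebra is infinite-dimensional. *)
Lemma filtration_finite B M n u :
  fil B M n u -> exists L : seq g, fil (fun b => b \in L) M n u.
Proof.
elim=> {n u} [n|n u Mu|n a u v _ [L Fu] _ [L' Fv]|n b u Bb _ [L Fu]].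
- by exists [::]; apply: Filtration0.
- by exists [::]; apply: FiltrationBase.
- exists (L ++ L'); apply: FiltrationLin.
    by apply: filtration_mono Fu => b; rewrite mem_cat => ->.
  by apply: filtration_mono Fv => b; rewrite mem_cat orbC => ->.
- exists (b :: L); apply: FiltrationAct; first exact: mem_head.
  by apply: filtration_mono Fu => c; rewrite inE orbC => ->.
Qed.

(** * Quasi-Whittaker vectors and the Euler operator on the filtration *)

Hypothesis Hlie : is_lie_bracket br.
Variables (P : g -> Prop) (phi : g -> K).
Hypotheses (HP : lie_ideal br P) (Hphi : lie_hom_on br P phi).
Local Notation A := (whittaker_annihilator br P phi).
Local Notation qW := (quasi_whittaker P phi act).

Lemma quasi_whittaker_subspace : subspace qW.
Proof.
split=> [x _|a u v qu qv x Px]; first by rewrite lie_act0 scaler0.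
by rewrite lie_actD lie_actZ qu // qv // scalerDr !scalerA mulrC.
Qed.

(** Moving [x] past [z] costs the action of [br x z], an element of [P] that acts on [u] by the
    scalar [phi (br x z) = 0]. *)
Lemma quasi_whittaker_act z u : A z -> qW u -> qW (act z u).
Proof.
move=> Az qu x Px.
have Pxz : P (br x z).
  by rewrite (lie_bracketC Hlie) -scaleN1r; apply: subspaceZ; case: HP => // _; apply.
rewrite lie_actC (qu x) // lie_actZ (qu _ Pxz).
by have /(whittaker_annihilatorP Hlie HP Hphi) -> := Az; rewrite // scale0r addr0.
Qed.

Variable M : V -> Prop.
Hypotheses (Msub : subspace M) (MqW : forall u, M u -> qW u).
Hypothesis MA : forall z u, A z -> M u -> M (act z u).
Local Notation F := (fil (fun=> True) M).
Local Notation D x u := (act x u - phi x *: u).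

Let FB n u v : F n u -> F n v -> F n (u - v).
Proof. exact: subspaceB (filtration_subspace _ _ _). Qed.
Let FD n u v : F n u -> F n v -> F n (u + v).
Proof. exact: subspaceD (filtration_subspace _ _ _). Qed.
Let FZ n a u : F n u -> F n (a *: u).
Proof. exact: subspaceZ (filtration_subspace _ _ _). Qed.

(** Induction with [x] varying: [D x (act b u)] is [act b (D x u)] plus [act (br x b) u], and
    [br x b] in [P] acts as [D (br x b)] plus a scalar. Since stage 0 is zero, the convention
    [0.-1 = 0] is harmless. *)
Lemma filtration_lower n x u : P x -> F n u -> F n.-1 (D x u).
Proof.
move=> Px Fu; elim: Fu x Px => {n u} [n|n u Mu|n a u v _ Fu _ Fv|n b u Bb Fu IH] x Px.
- by rewrite lie_act0 scaler0 subrr; apply: Filtration0.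
- by rewrite (MqW Mu) // subrr; apply: Filtration0.
- rewrite lie_actD lie_actZ [phi x *: _]scalerDr opprD addrACA.
  rewrite [phi x *: (a *: u)]scalerA mulrC -scalerA -scalerBr.
  by apply: FiltrationLin; [exact: Fu|exact: Fv].
- rewrite /= lie_actC -lie_actZ addrAC -lie_actB; apply: FD.
    by apply: filtration_act => //; apply: IH.
  have Pxb : P (br x b).
    by rewrite (lie_bracketC Hlie) -scaleN1r; apply: subspaceZ; case: HP => // _; apply.
  rewrite -[act _ u](subrK (phi (br x b) *: u)); apply: FD; last exact: FZ.
  exact/filtrationS/IH.
Qed.

(** Moving [z] inward past [b] replaces [b] by [br z b], which leaves the number of factors
    unchanged; the innermost vector stays in [M]. *)
Lemma filtration_annihilator n z u : A z -> F n u -> F n (act z u).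
Proof.
move=> Az; elim=> {n u} [n|n u Mu|n a u v _ Fu _ Fv|n b u Bb Fu IH].
- by rewrite lie_act0; apply: Filtration0.
- by apply: FiltrationBase; apply: MA.
- by rewrite lie_actD lie_actZ; apply: FiltrationLin.
- rewrite lie_actC; apply: FD; first exact: FiltrationAct.
  exact: filtration_act.
Qed.

(** Commuting the Euler operator past a factor [b] produces [act T u] with [T] congruent to [b]
    modulo [A], so each factor adds one to the eigenvalue. Stage [n.+1] holds products of at most
    [n] factors, hence the eigenvalue [n]. *)
Lemma euler_operator (L : seq g) (zs : seq (g * g)) n u :
  (forall p, p \in zs -> P p.2) ->
  (forall b, b \in L -> A (b - \sum_(p <- zs) phi (br p.2 b) *: p.1)) ->
  fil (fun b => b \in L) M n.+1 u ->
  F n (\sum_(p <- zs) act p.1 (D p.2 u) - n%:R *: u).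
Proof.
move=> Pzs HL; move En : n.+1 => m Fu.
elim: Fu n En => {m u} [m|m u Mu|m a u v Fu IHu Fv IHv|m b u Lb Fu IH] n En.
- rewrite scaler0 subr0; apply: (subspace_sum (filtration_subspace _ _ _)) => p _.
  by rewrite lie_act0 scaler0 subrr lie_act0; apply: Filtration0.
- have -> : \sum_(p <- zs) act p.1 (D p.2 u) = 0.
    by rewrite big_seq big1 // => p /Pzs Pp; rewrite (MqW Mu) // subrr lie_act0.
  (* What remains is [- n] times [u]: zero for [n = 0], and otherwise in stage [n], because every
     positive stage contains [M]. *)
  rewrite sub0r -scaleNr; case: n {En} => [|n].
    by rewrite oppr0 scale0r; exact: Filtration0.
  by apply: FZ; apply: FiltrationBase.
- rewrite (eq_bigr (fun p => a *: act p.1 (D p.2 u) + act p.1 (D p.2 v))).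
    rewrite big_split -scaler_sumr scalerDr opprD addrACA scalerA mulrC -scalerA.
    by rewrite -scalerBr; apply: FiltrationLin; [exact: IHu|exact: IHv].
  move=> p _; rewrite -lie_actZ -lie_actD; congr act.
  rewrite lie_actD lie_actZ scalerBr scalerDr.
  by rewrite opprD addrACA !scalerA mulrC.
- have {IH} IH := IH _ erefl; case: En => ->.
  have {}Fu : F m.+1 u by apply: filtration_mono Fu.
  pose E v := \sum_(p <- zs) act p.1 (D p.2 v).
  pose T := \sum_(p <- zs) phi (br p.2 b) *: p.1.
  (* The scalar [m.+1] is split as [m] plus 1: the first part joins the induction hypothesis under
     [act b], the second combines with [act T u] into the action of [b - T], an element of [A]. *)
  have -> : \sum_(p <- zs) act p.1 (D p.2 (act b u)) - m.+1%:R *: act b u =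
      act b (E u - m%:R *: u) + \sum_(p <- zs) act (br p.1 b) (D p.2 u)
      + \sum_(p <- zs) act p.1 (D (br p.2 b) u) - act (b - T) u.
    rewrite (eq_bigr (fun p => act b (act p.1 (D p.2 u))
        + act (br p.1 b) (D p.2 u) + act p.1 (D (br p.2 b) u)
        + phi (br p.2 b) *: act p.1 u)); last first.
      move=> p _.
      (* The scalar term is the only one without a [D]; acted on by [p.1] and summed over [zs], it
         becomes [act T u]. *)
      have -> : D p.2 (act b u) =
          act b (D p.2 u) + (D (br p.2 b) u + phi (br p.2 b) *: u).
        by rewrite subrK lie_actC lie_actB lie_actZ addrAC.
      rewrite lie_actD [act p.1 (act b _)]lie_actC [act p.1 (_ + _ *: _)]lie_actD.
      by rewrite [act p.1 (_ *: _)]lie_actZ !addrA.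
    rewrite !big_split -!lie_act_sum -/(E u) /=.
    have -> : \sum_(p <- zs) phi (br p.2 b) *: act p.1 u = act T u.
      by rewrite lie_act_suml; apply: eq_bigr => p _; rewrite lie_actZl.
    rewrite lie_actBl opprB lie_actB -[m.+1]addn1 natrD scalerDl scale1r opprD.
    rewrite lie_actZ !addrA; congr (_ - _); rewrite -!addrA; congr (_ + _).
    by rewrite [RHS]addrC -!addrA.
  have Pxb p : p \in zs -> P (br p.2 b).
    move=> /Pzs Pp; rewrite (lie_bracketC Hlie) -scaleN1r.
    by apply: subspaceZ; case: HP => // _; apply.
  apply: FB; last by apply: filtration_annihilator => //; apply: HL.
  apply: FD; [apply: FD; first exact: filtration_act|];
    apply: (subspace_sum (filtration_subspace _ _ _)) => p pzs;
    apply: filtration_act => //; apply: (filtration_lower (n := m.+1)) => //.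
  + exact: Pzs.
  + exact: Pxb.
Qed.

Lemma filtration_leq n m u : (n <= m)%N -> F n u -> F m u.
Proof. by move=> /subnK <- Fu; elim: (m - n)%N => // k; apply: filtrationS. Qed.

(** The Euler operator kills [u], so for [u] in stage [n.+2] the multiple [n.+1] of [u] lies in
    stage [n.+1]. Characteristic 0 allows division, and the descent ends at stage 1, which is
    [M]. *)
Lemma quasi_whittaker_filtration n u :
  [pchar K] =i pred0 -> qW u -> F n u -> M u.
Proof.
move=> /pcharf0P char0 qu; elim: n => [|[|n] IH] Fu.
- by rewrite (filtration_bottom Fu); case: Msub.
- exact: filtration_base Fu.
- have [L FLu] := filtration_finite Fu.
  have [zs Pzs HL] := dual_family Hlie HP Hphi L.
  have := euler_operator Pzs HL FLu; rewrite big_seq big1 => [|p /Pzs Pp].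
    rewrite sub0r -scaleNr => /(FZ (- n.+1%:R)^-1).
    by rewrite scalerA mulVf ?oppr_eq0 ?char0 // scale1r; apply: IH.
  by rewrite qu // subrr lie_act0.
Qed.

(** The union of the stages is a stable subspace containing [M], so generation places every vector
    in some stage, where the descent applies. *)
Lemma quasi_whittaker_generated :
  [pchar K] =i pred0 ->
  (forall S : V -> Prop, subspace S -> (forall u, M u -> S u) ->
     (forall x u, S u -> S (act x u)) -> forall u, S u) ->
  forall u, qW u <-> M u.
Proof.
move=> char0 gen u; split; last exact: MqW.
move=> qu; suff [n] : exists n, F n u by apply: quasi_whittaker_filtration.
move: u {qu}; apply: gen => [|u Mu|x u [n Fu]].
- split=> [|a u v [n Fu] [m Fv]]; first by exists 0%N; apply: Filtration0.
  exists (maxn n m); apply: FiltrationLin.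
    by apply: filtration_leq Fu; apply: leq_maxl.
  by apply: filtration_leq Fv; apply: leq_maxr.
- by exists 1%N; apply: FiltrationBase.
- by exists n.+1; apply: filtration_act.
Qed.

End LieModule.

(** * Straightening of monomials in a complement of [P] inside the annihilator *)

Section OrderedMonomials.
Variables (K : fieldType) (g : lmodType K) (br : g -> g -> g).
Hypothesis Hlie : is_lie_bracket br.
Variables (P : g -> Prop) (phi : g -> K).
Hypotheses (HP : lie_ideal br P) (Hphi : lie_hom_on br P phi).
Local Notation A := (whittaker_annihilator br P phi).
Variables (d : Order.disp_t) (J : orderType d) (y : J -> g).
Hypothesis Hy : forall z, A z <->
  exists a b, [/\ lin_span (fun x => exists j, x = y j) a, P b & z = a + b].
Variables (V : lmodType K) (act : g -> V -> V) (w : V).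
Hypothesis Hact : is_lie_module br act.
Hypothesis qw : quasi_whittaker P phi act w.

(** Straightening is done on words: lists of indices with repetitions in place of exponents. [Ord n]
    is spanned by weakly sorted words of length at most [n]. *)
Local Notation mono := (foldr (fun j => act (y j)) w).
Local Notation Ord n := (lin_span (fun u =>
  exists t : seq J, [/\ sorted <=%O t, (size t <= n)%N & u = mono t])).

Lemma complement_annihilator j : A (y j).
Proof.
apply/Hy; exists (y j), 0; split; last by rewrite addr0.
  by apply: lin_span_gen; exists j.
by case: HP => -[].
Qed.

Let OrdD n u v : Ord n u -> Ord n v -> Ord n (u + v).
Proof. exact: subspaceD (lin_span_subspace _). Qed.
Let OrdZ n a u : Ord n u -> Ord n (a *: u).
Proof. exact: subspaceZ (lin_span_subspace _). Qed.

Let Ord_leq n m u : (n <= m)%N -> Ord n u -> Ord m u.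
Proof.
move=> nm; apply: lin_span_min => [|_ [t [ts tn ->]]].
  exact: lin_span_subspace.
by apply: lin_span_gen; exists t; split=> //; apply: leq_trans nm.
Qed.

Lemma act_preimage_subspace (S : V -> Prop) z :
  subspace S -> subspace (fun u => S (act z u)).
Proof.
move=> [S0 Sl]; split=> [|a u v Su Sv]; first by rewrite (lie_act0 Hact).
by rewrite (lie_actD Hact) (lie_actZ Hact); apply: Sl.
Qed.

Lemma act_preimage_subspacel (S : V -> Prop) u :
  subspace S -> subspace (fun z => S (act z u)).
Proof.
move=> [S0 Sl]; split=> [|a z z' Sz Sz']; first by rewrite (lie_act0l Hact).
by rewrite (lie_actDl Hact) (lie_actZl Hact); apply: Sl.
Qed.

Lemma monomial_quasi_whittaker t : quasi_whittaker P phi act (mono t).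
Proof.
elim: t => //= j t IH.
exact: (quasi_whittaker_act Hact Hlie HP Hphi (complement_annihilator j)).
Qed.

(** The [P] part of [z] acts on words by scalars, and the complement part prepends letters, which
    sorting absorbs. Sorting is a hypothesis bounded by [n] so that this step can serve inside the
    induction proving it. *)
Let act_Ord_of_sort n :
  (forall m, (m <= n)%N -> forall j t, sorted <=%O t -> size t = m ->
     Ord m (mono (j :: t) - mono (sort <=%O (j :: t)))) ->
  forall z u, A z -> Ord n u -> Ord n.+1 (act z u).
Proof.
move=> Hsort z u /Hy [a [b [Ya Pb ->]]].
apply: (lin_span_min (T := fun u => Ord n.+1 (act (a + b) u))) => [|_ [t [ts tn ->]]].
  exact/act_preimage_subspace/lin_span_subspace.
rewrite (lie_actDl Hact) (monomial_quasi_whittaker _ Pb); apply: OrdD; last first.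
  by apply: OrdZ; apply: lin_span_gen; exists t; split=> //; apply: leqW.
move: a Ya.
apply: (lin_span_min (T := fun a => Ord n.+1 (act a (mono t)))) => [|_ [j ->]].
  exact/act_preimage_subspacel/lin_span_subspace.
rewrite -[act _ _](subrK (mono (sort <=%O (j :: t)))); apply: OrdD.
  by apply: (@Ord_leq (size t)); [exact: leqW|apply: Hsort].
apply: lin_span_gen; exists (sort <=%O (j :: t)).
by rewrite sort_sorted ?size_sort; last exact: le_total.
Qed.

(** The spanning half of the PBW argument, by strong induction on length: swapping two letters costs
    a bracket, which lies in [A] and acts on a shorter word. *)
Let mono_sort n j t : sorted <=%O t -> size t = n ->
  Ord n (mono (j :: t) - mono (sort <=%O (j :: t))).
Proof.
elim/ltn_ind: n j t => n IH j [|k t].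
  by move=> _ _; rewrite [sort _ _]/= subrr; case: (lin_span_subspace _ : subspace (Ord n)).
move=> kts szt; have [jk|kj] := leP j k.
  rewrite sorted_sort //=; first by rewrite subrr; case: (lin_span_subspace _ : subspace (Ord n)).
    exact: le_trans.
  by rewrite jk.
case: n IH szt => // n IH [szt].
have act_Ord : forall z u, A z -> Ord n u -> Ord n.+1 (act z u).
  by apply: act_Ord_of_sort => m mn; apply: IH.
have ts : sorted <=%O t by apply: path_sorted kts.
have kt : all (>= k)%O t by apply: order_path_min kts; apply: le_trans.
(* Here [k] is below [j] and at most every letter of [t], so it comes first after sorting. *)
have -> : sort <=%O [:: j, k & t] = k :: sort <=%O (j :: t).
  apply: (sorted_eq le_trans le_anti).
  - by apply: sort_sorted; apply: le_total.
  - rewrite /= path_min_sorted; first by apply: sort_sorted; apply: le_total.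
    by rewrite all_sort /= ltW.
  - rewrite perm_sort -[in X in perm_eq X](cat1s j) -[in X in perm_eq X](cat1s k).
    by rewrite perm_catCA /= perm_cons perm_sym perm_sort.
(* After the swap, [y k] acts on the sorting error of [j :: t], which lies in [Ord n] by induction,
   and the bracket of [y j] and [y k] acts on [mono t], also in [Ord n]. *)
rewrite /= (lie_actC Hact) addrAC -(lie_actB Hact); apply: OrdD.
  apply: act_Ord; first exact: complement_annihilator.
  exact: IH.
apply: act_Ord.
  by apply: (whittaker_annihilator_bracket Hlie HP Hphi); apply: complement_annihilator.
by apply: lin_span_gen; exists t; rewrite szt.
Qed.

Let act_Ord n z u : A z -> Ord n u -> Ord n.+1 (act z u).
Proof. by apply: act_Ord_of_sort => m _ j t ts; apply: mono_sort. Qed.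

(** Equal neighbours are collected into exponents. The inclusion of the indices of [s] in [t] bounds
    the head of [s] below by the next letter, so strict sortedness survives. *)
Lemma sorted_monomial t : sorted <=%O t ->
  exists2 s : seq (J * nat), sorted <%O (map fst s) /\ {subset map fst s <= t} &
    mono t = ordered_monomial_act act y s w.
Proof.
elim: t => [_|j t IH jts] /=; first by exists [::].
have [s [ss sst] ->] := IH (path_sorted jts).
have jt : all (>= j)%O t by apply: order_path_min jts; apply: le_trans.
case: s ss sst => [|[k m] s] ss sst.
  by exists [:: (j, 1%N)] => //; split=> // k; rewrite !inE => ->.
have : (j <= k)%O by apply: (allP jt); apply: sst; rewrite mem_head.
rewrite le_eqVlt => /orP[/eqP jk|jk].
  exists ((k, m.+1) :: s); last by rewrite /= jk.
  by split=> // i /sst; rewrite inE orbC => ->.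
exists ((j, 1%N) :: (k, m) :: s) => //; split; first by rewrite /= jk.
by move=> i; rewrite inE => /orP[/eqP->|/sst]; rewrite inE ?eqxx // orbC => ->.
Qed.

Lemma ordered_monomials_quasi_whittaker u :
  lin_span (ordered_monomial_vec act y w) u -> quasi_whittaker P phi act u.
Proof.
apply: lin_span_min => [|_ [s [_ ->]]]; first exact: (quasi_whittaker_subspace Hact).
elim: s => //= -[j m] s IH /=; elim: m => //= m IHm.
exact: (quasi_whittaker_act Hact Hlie HP Hphi (complement_annihilator j)).
Qed.

(** An ordered monomial is first expanded into sorted words, built up from [w] one letter at a time;
    [z] then acts within the spaces [Ord n], and the resulting words are regrouped into powers. *)
Lemma ordered_monomials_stable z u : A z ->
  lin_span (ordered_monomial_vec act y w) u ->
  lin_span (ordered_monomial_vec act y w) (act z u).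
Proof.
move=> Az; apply: (lin_span_min (T := fun u => lin_span _ (act z u))) => [|_ [s [_ ->]]].
  exact/act_preimage_subspace/lin_span_subspace.
have [n On] : exists n, Ord n (ordered_monomial_act act y s w).
  elim: s => [|[j m] s IH] /=.
    by exists 0%N; apply: lin_span_gen; exists [::].
  elim: m => //= m [n IHm]; exists n.+1.
  by apply: act_Ord => //; apply: complement_annihilator.
apply: lin_span_min (act_Ord Az On) => [|_ [t [ts _ ->]]].
  exact: lin_span_subspace.
have [r [rs _] ->] := sorted_monomial ts.
by apply: lin_span_gen; exists r.
Qed.

End OrderedMonomials.

Theorem theorem3p1 (R : realType) (g : lmodType R[i]) (br : g -> g -> g)
  (Hlie : is_lie_bracket br)
  (Hnss : ~ semisimple br)
  (P : g -> Prop) (HPideal : lie_ideal br P) (HPnp : ~ perfect br P)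
  (phi : g -> R[i]) (Hphi : lie_hom_on br P phi)
  (d : Order.disp_t) (J : orderType d) (y : J -> g)
  (Hy_indep : forall (n : nat) (c : 'I_n -> R[i]) (j : 'I_n -> J),
      injective j -> \sum_(i < n) c i *: y (j i) = 0 -> forall i, c i = 0)
  (Hy_compl :
     let Y := lin_span (fun x => exists j, x = y j) in
     (forall z, Y z -> P z -> z = 0) /\
     (forall z, whittaker_annihilator br P phi z <->
                exists a b, [/\ Y a, P b & z = a + b]))
  (W : lmodType R[i]) (actW : g -> W -> W) (w : W)
  (HW : universal_qwhittaker br P phi actW w) :
  forall u : W,
    quasi_whittaker P phi actW u <->
    lin_span (ordered_monomial_vec actW y w) u.
Proof.
have [Hact qw _] := HW; have [_ Hy] := Hy_compl.
apply: (quasi_whittaker_generated Hact Hlie HPideal Hphi).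
- exact: lin_span_subspace.
- exact: (ordered_monomials_quasi_whittaker Hlie HPideal Hphi Hy Hact qw).
- exact: (ordered_monomials_stable Hlie HPideal Hphi Hy Hact qw).
- exact: Num.Theory.pchar_num.
(* The vector [w] is the empty monomial, so a stable subspace containing the span contains the
   generator of [W]. *)
- move=> S Ssub MS Sstab; apply: (universal_qwhittaker_generated HW) => //.
  by apply: MS; apply: lin_span_gen; exists [::].
Qed.
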